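(* Let $d\ge 1$ be an integer and define $\kappa(d)\in\mathbb{R}\cup\{\infty\}$ to be the infimum of all real numbers $\kappa$ such that every bridgeless simplicial complex of dimension $d$ has a nowhere-zero $q$-flow for some positive integer $q\le \kappa$ (with $\inf\emptyset=\infty$). Then $\kappa(d)>d+2$.
   Context: All simplicial complexes are finite. For a simplicial complex $\Delta$ of dimension $d$, let $F$ be its set of $d$-simplices (facets) and $R$ its set of $(d-1)$-simplices (ridges); fix an orientation of each simplex and let $\partial\in\mathbb{Z}^{R\times F}$ be the simplicial boundary matrix. For a positive integer $q$, a $q$-flow of $\Delta$ is a vector $\varphi\in\{0,\dots,q-1\}^{F}$ with $\partial\varphi\equiv 0 \pmod q$; it is nowhere-zero if $\varphi\in\{1,\dots,q-1\}^F$. Homology is reduced homology and $\beta_n(Y)$ denotes the rank of $H_n(Y;\mathbb{Z})$. For $X\subseteq F$, $\Delta\setminus X$ denotes the subcomplex consisting of the facets in $F\setminus X$ together with all simplices of $\Delta$ of dimension at most $d-1$. A facet $f$ is a bridge if $\beta_{d-1}(\Delta\setminus\{f\})=\beta_{d-1}(\Delta)+1$; $\Delta$ is bridgeless if it has no bridge. *)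

(* Defs.v *)
From HB Require Import structures.
From mathcomp Require Import all_boot all_order all_algebra.
From mathcomp Require Import boolp.

Set Implicit Arguments.
Unset Strict Implicit.
Unset Printing Implicit Defensive.

Import Order.TTheory GRing.Theory Num.Theory.

Local Open Scope ring_scope.

Section Complexes.
Variable V : finType.
Implicit Types (Delta Y : {set {set V}}) (s t f : {set V}).

Definition simplicial_complex Delta : bool :=
  (set0 \in Delta) &&
  [forall s in Delta, forall t : {set V}, (t \subset s) ==> (t \in Delta)].

Definition of_dimension Delta (d : nat) : bool :=
  (\max_(s in Delta) #|s|)%N == d.+1.

(* Indexed by the number k of vertices, i.e. the simplices of dimension k - 1;
   k = 0 gives the empty simplex, so that the homology below is reduced. *)
Definition simplices Delta (k : nat) : {set {set V}} :=
  [set s in Delta | #|s| == k].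

(* Simplices are oriented by the order of V given by [enum_rank]: this is the
   coefficient of t in the sum over v in s of (-1)^(position of v in s) (s - v). *)
Definition incidence t s : int :=
  \sum_(v in s | s :\ v == t)
    (-1) ^+ #|[set u in s | (enum_rank u < enum_rank v)%N]|.

(* The boundary from n-chains to (n - 1)-chains. *)
Definition boundary_mx Y (n : nat) :
    'M[int]_(#|simplices Y n|, #|simplices Y n.+1|) :=
  \matrix_(i, j) incidence (enum_val i) (enum_val j).

(* The k columns of z are n-cycles whose classes in H_n(Y; Z) are linearly
   independent over Z. *)
Definition homology_free Y (n k : nat) (z : 'M[int]_(#|simplices Y n.+1|, k)) :
    Prop :=
  boundary_mx Y n *m z = 0 /\
  forall c : 'cV[int]_k,
    (exists b, z *m c = boundary_mx Y n.+1 *m b) -> c = 0.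

(* The rank of H_n(Y; Z), as the largest size of a linearly independent family;
   such a family lifts to independent n-chains, hence the bound on k. *)
Definition betti Y (n : nat) : nat :=
  (\max_(k < #|simplices Y n.+1|.+1 |
      `[< exists z : 'M[int]_(_, k), @homology_free Y n k z >]) k)%N.

Definition bridge Delta (d : nat) f : bool :=
  (f \in simplices Delta d.+1) &&
  (betti (Delta :\ f) d.-1 == (betti Delta d.-1).+1).

Definition bridgeless Delta (d : nat) : bool :=
  [forall f, ~~ bridge Delta d f].

Definition is_flow Delta (d q : nat) (phi : 'cV[int]_#|simplices Delta d.+1|) :
    Prop :=
  (forall j, 0 <= phi j 0 < q%:Z) /\
  (forall i, ((boundary_mx Delta d *m phi)%R i 0%R = 0 %[mod q])%Z).

Definition nowhere_zero_flow Delta (d q : nat)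
    (phi : 'cV[int]_#|simplices Delta d.+1|) : Prop :=
  is_flow q phi /\ forall j, phi j 0 != 0.

End Complexes.

From mathcomp Require Import classical_sets reals constructive_ereal ereal.

Definition flow_bound (R : realType) (d : nat) (k : R) : Prop :=
  forall (V : finType) (Delta : {set {set V}}),
    simplicial_complex Delta -> of_dimension Delta d -> bridgeless Delta d ->
    exists q : nat, [/\ (0 < q)%N, q%:R <= k &
      exists phi : 'cV[int]_#|simplices Delta d.+1|, nowhere_zero_flow q phi].

Definition kappa (R : realType) (d : nat) : \bar R :=
  ereal_inf [set k%:E | k in [set k : R | flow_bound d k]]%classic.

(* Main.v *)
(* The d-skeleton of a simplex with d+3 vertices has no nowhere-zero q-flow for
   q <= d+2. It lies in the sphere bounding the simplex, whose d+3 chambers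
   (one opposite each vertex) are pairwise adjacent along its facets, so flows
   mod q are differences of chamber labels: writing phi_ab for the value on the
   facet missing a and b, and y_a = (-1)^a phi_0a, y_0 = 0, the flow condition
   gives phi_ab = +-(y_b - y_a) mod q. A nowhere-zero flow makes the d+3 labels
   distinct mod q. No facet f is a bridge, because the boundary of the simplex
   on f and one more vertex is a cycle through f. *)
Require Import Defs.
From mathcomp Require Import all_boot all_order all_algebra.
From mathcomp Require Import boolp.
From mathcomp Require Import zify ring.

Set Implicit Arguments.
Unset Strict Implicit.
Unset Printing Implicit Defensive.

Import Order.TTheory GRing.Theory Num.Theory.

Local Open Scope ring_scope.

(** * Signed incidence numbers *)

Section Incidence.
Variable V : finType.
Implicit Types (r s t f : {set V}) (u v : V) (A B C : {set {set V}}).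

Definition position s v : nat :=
  #|[set u in s | (enum_rank u < enum_rank v)%N]|.

Lemma incidenceE t s :
  incidence t s = \sum_(v in s | s :\ v == t) (-1) ^+ position s v.
Proof. by []. Qed.

Lemma position_setD1 s u v : u \in s ->
  position s v = ((enum_rank u < enum_rank v) + position (s :\ u) v)%N.
Proof.
move=> us; rewrite /position (cardsD1 u) inE us /=; congr (_ + #|pred_of_set _|)%N.
by apply/setP => x; rewrite !inE andbA.
Qed.

Lemma sum_incidence C r (g : {set V} -> int) :
    (forall v, v \in r -> r :\ v \in C) ->
  \sum_(s in C) g s * incidence s r =
  \sum_(v in r) g (r :\ v) * (-1) ^+ position r v.
Proof.
move=> rC; under eq_bigr do rewrite incidenceE big_distrr /=.
rewrite (exchange_big_dep (mem r)) /=; last by move=> s v _ /andP[].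
apply: eq_bigr => v vr; rewrite (big_pred1 (r :\ v)) // => s /=.
rewrite vr /= eq_sym; case: eqVneq => [->|_]; last by rewrite andbF.
by rewrite rC.
Qed.

Lemma sum_coincidence C t (g : {set V} -> int) :
    (forall v, v \notin t -> v |: t \in C) ->
  \sum_(s in C) incidence t s * g s =
  \sum_(v in ~: t) (-1) ^+ position (v |: t) v * g (v |: t).
Proof.
move=> tC; under eq_bigr do rewrite incidenceE big_distrl /=.
rewrite (exchange_big_dep (mem (~: t))) /=; last first.
  by move=> s v _ /andP[_ /eqP<-]; rewrite !inE eqxx.
apply: eq_bigr => v; rewrite inE => vt.
rewrite (big_pred1 (v |: t)) // => s /=.
apply/and3P/eqP => [[_ vs /eqP<-]|->]; first by rewrite setD1K.
by rewrite tC ?setU11 // setU1K.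
Qed.

(** Removing two vertices in either order leaves the same set, with opposite signs: only the
    position of the larger vertex drops by one when the other goes first. *)
Lemma boundary_boundary C r t : (forall v, v \in r -> r :\ v \in C) ->
  \sum_(s in C) incidence t s * incidence s r = 0.
Proof.
move=> /sum_incidence ->.
(* [F] extends the summand by zero to all ordered pairs of vertices; being antisymmetric, its total
   equals its own negative. *)
pose F v u : int := if [&& v \in r, u \in r, u != v & r :\ v :\ u == t]
  then (-1) ^+ position (r :\ v) u * (-1) ^+ position r v else 0.
have FN v u : F v u = - F u v.
  rewrite /F [v == u]eq_sym [r :\ u :\ v]setDDl setUC -setDDl.
  have [vr|] := boolP (v \in r); last by rewrite andbF oppr0.
  have [ur|] := boolP (u \in r); last by rewrite oppr0.
  have [->|uv] := eqVneq u v; first by rewrite oppr0.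
  case: ifP => _; rewrite ?oppr0 //.
  rewrite (position_setD1 u vr) (position_setD1 v ur) !exprD.
  have : (enum_rank u != enum_rank v :> nat).
    by apply: contra_neq uv => /ord_inj/enum_rank_inj.
  by case: ltngtP => // _ _; rewrite /=; ring.
have -> : \sum_(v in r) incidence t (r :\ v) * (-1) ^+ position r v =
          \sum_v \sum_u F v u.
  rewrite big_mkcond; apply: eq_bigr => v _; rewrite /F.
  have [vr|_] := boolP (v \in r); last by rewrite big1.
  rewrite incidenceE big_distrl /= big_mkcond; apply: eq_bigr => u _.
  by rewrite !inE /= andbA [_ && (u != v)]andbC.
have : \sum_v \sum_u F v u = - \sum_v \sum_u F v u.
  rewrite {1}exchange_big -sumrN; apply: eq_bigr => v _.
  by rewrite -sumrN; apply: eq_bigr.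
lia.
Qed.

Lemma incidence_setU1_neq0 f v : v \notin f -> incidence f (v |: f) != 0.
Proof.
move=> vf; rewrite incidenceE (big_pred1 v) ?signr_eq0 // => u /=.
rewrite !inE; have [->|uv] /= := eqVneq u v; first by rewrite setU1K ?eqxx.
apply/negP => /andP[_ /eqP /setP /(_ v)].
by rewrite !inE eq_sym uv eqxx (negbTE vf).
Qed.

(** * Chains and Betti numbers *)

Definition incidence_mx A B : 'M[int]_(#|A|, #|B|) :=
  \matrix_(i, j) incidence (enum_val i) (enum_val j).

Definition chain_col A (g : {set V} -> int) : 'cV[int]_#|A| :=
  \col_i g (enum_val i).

(** Functions on all sets let one chain be read over both [C] and [C :\ f], whose index types
    differ. *)
Lemma chain_colP A (b : 'cV[int]_#|A|) : exists g, b = chain_col A g.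
Proof.
exists (fun s => \sum_(j | enum_val j == s) b j 0).
apply/colP => i; rewrite mxE (big_pred1 i) // => j.
by rewrite (inj_eq enum_val_inj).
Qed.

Lemma incidence_mx_chain A B g (i : 'I_#|A|) :
  (incidence_mx A B *m chain_col B g) i 0 =
  \sum_(s in B) incidence (enum_val i) s * g s.
Proof.
by rewrite mxE [RHS]big_enum_val; apply: eq_bigr => j _; rewrite !mxE.
Qed.

(* [homology_free] and [betti] in terms of the sets of simplices in the three
   relevant dimensions only, so that these sets can be rewritten. *)
Definition chain_free A B C k (z : 'M[int]_(#|B|, k)) : Prop :=
  incidence_mx A B *m z = 0 /\
  forall c : 'cV[int]_k,
    (exists b, z *m c = incidence_mx B C *m b) -> c = 0.

Definition chain_betti A B C : nat :=
  (\max_(k < #|B|.+1 | `[< exists z : 'M[int]_(_, k), @chain_free A B C k z >]) k)%N.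

Lemma bettiE Y n :
  betti Y n =
  chain_betti (simplices Y n) (simplices Y n.+1) (simplices Y n.+2).
Proof. by []. Qed.

(* A cycle with nonzero coefficient at [f] makes a nonzero multiple of the
   boundary of [f] a combination of the other boundaries. *)
Lemma chain_betti_setD1 A B C f (w : {set V} -> int) :
    (forall t, \sum_(s in C) incidence t s * w s = 0) -> w f != 0 ->
    f \in C ->
  (chain_betti A B (C :\ f) <= chain_betti A B C)%N.
Proof.
move=> wcyc wf fC; apply/bigmax_leqP => k /asboolP[z [zcyc zfree]].
apply: (leq_bigmax_cond (P := fun k : 'I_#|B|.+1 =>
  `[< exists z : 'M[int]_(_, k), @chain_free A B C k z >]) (F := @nat_of_ord _)).
apply/asboolP; exists z; split=> // c [b].
have [g ->] := chain_colP b => zc.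
have /eqP : w f *: c = 0.
  (* Subtracting [g f] times the cycle [w] from [w f * g] cancels the coefficient at [f] and leaves
     the boundary equal to [w f] times that of [g]. *)
  apply: zfree; exists (chain_col _ (fun s => w f * g s - g f * w s)).
  rewrite -scalemxAr zc; apply/colP => i.
  rewrite mxE !incidence_mx_chain.
  have := wcyc (enum_val i); rewrite (big_setD1 f fC) /= => /eqP.
  rewrite addr_eq0 => /eqP wi.
  rewrite (big_setD1 f fC) /= mulrDr.
  have -> : \sum_(s in C :\ f) incidence (enum_val i) s * (w f * g s - g f * w s)
    = w f * (\sum_(s in C :\ f) incidence (enum_val i) s * g s)
      - g f * \sum_(s in C :\ f) incidence (enum_val i) s * w s.
    rewrite !big_distrr -sumrB; apply: eq_bigr => s _ /=; ring.
  rewrite addrC; congr (_ + _).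
  by move: wi => /eqP; rewrite -eqr_oppLR => /eqP <-; ring.
move=> /eqP wc; apply/colP => i; move/colP/(_ i)/eqP: wc.
by rewrite !mxE mulf_eq0 (negbTE wf) => /eqP.
Qed.

End Incidence.

(** * The d-skeleton of the simplex on d+3 vertices *)

Section CompleteComplex.
Variable d : nat.
Implicit Types s t f : {set 'I_d.+3}.

Definition complete_complex : {set {set 'I_d.+3}} :=
  [set s : {set 'I_d.+3} | (#|s| <= d.+1)%N].

Lemma in_simplices_complete k s : (k <= d.+1)%N ->
  (s \in simplices complete_complex k) = (#|s| == k).
Proof. by move=> kd; rewrite !inE andbC; case: eqVneq => // ->. Qed.

Lemma complete_complex_simplicial : simplicial_complex complete_complex.
Proof.
rewrite /simplicial_complex inE cards0 /=.
apply/forallP => s; apply/implyP; rewrite inE => sd.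
apply/forallP => t; apply/implyP => ts; rewrite inE.
exact: leq_trans (subset_leq_card ts) sd.
Qed.

Definition facet (a b : 'I_d.+3) : {set 'I_d.+3} := [set: 'I_d.+3] :\ a :\ b.

Lemma card_facet a b : a != b -> #|facet a b| = d.+1.
Proof.
move=> ab; have := cardsD1 b ([set: 'I_d.+3] :\ a).
have := cardsD1 a [set: 'I_d.+3].
by rewrite !inE /facet eq_sym ab cardsT card_ord !add1n => -[E1] E2; apply: succn_inj; rewrite -E2 -E1.
Qed.

Lemma complete_complex_dimension : of_dimension complete_complex d.
Proof.
rewrite /of_dimension eqn_leq; apply/andP; split.
  by apply/bigmax_leqP => s; rewrite inE.
have f0 : #|facet ord0 ord_max| = d.+1 by exact: card_facet.
apply: (leq_trans (eq_leq (esym f0))); by apply: leq_bigmax_cond; rewrite inE f0.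
Qed.

Lemma complete_complex_bridgeless : (0 < d)%N -> bridgeless complete_complex d.
Proof.
move=> d_gt0; apply/forallP => f; apply/negP => /andP[fC].
have cf : #|f| = d.+1 by move: fC; rewrite in_simplices_complete // => /eqP.
(* Of the three sets of simplices that determine the Betti number in dimension d-1, deleting [f]
   changes only the top one. *)
have simplD1 k : (k <= d)%N ->
    simplices (complete_complex :\ f) k = simplices complete_complex k.
  move=> kd; apply/setP => s; rewrite !inE; have [->|//] := eqVneq s f.
  by rewrite cf; case: eqP => [E|]; rewrite ?andbF //; lia.
have simplD1d : simplices (complete_complex :\ f) d.+1 =
    simplices complete_complex d.+1 :\ f.
  by apply/setP => s; rewrite !inE andbA.
have [b bf] : exists b, b \notin f.
  apply/existsP; rewrite -negb_forall; apply/negP => /forallP fT.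
  have : f = [set: _] by apply/setP => x; rewrite fT inE.
  by move/(congr1 (fun A : {set _} => #|A|)); rewrite cf cardsT card_ord; lia.
rewrite !bettiE prednK // simplD1d !simplD1 ?leq_pred // => /eqP E.
suff : (chain_betti (simplices complete_complex d.-1)
      (simplices complete_complex d) (simplices complete_complex d.+1 :\ f)
   <= chain_betti (simplices complete_complex d.-1)
      (simplices complete_complex d) (simplices complete_complex d.+1))%N.
  by rewrite E ltnn.
(* The cycle through [f] is the boundary of [b |: f]; that set has d+2 vertices and is not in the
   complex, but its faces are. *)
apply: (chain_betti_setD1 _ _ _ (incidence_setU1_neq0 bf) fC
  (w := fun s => incidence s (b |: f))) => t.
apply: boundary_boundary => v vr; rewrite in_simplices_complete //.
by have := cardsD1 v (b |: f); rewrite vr cardsU1 bf cf; lia.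
Qed.

(** * Flows on the skeleton *)

Lemma positionT (a : 'I_d.+3) : position [set: _] a = a.
Proof.
rewrite /position -[RHS]card_ord -(card_codom (f := widen_ord (ltnW (ltn_ord a)))).
  apply: eq_card => u; rewrite !inE !enum_rank_ord /=.
  apply/idP/codomP => [ua|[v ->] //=].
  by exists (Ordinal ua); apply: val_inj.
by move=> u v /(congr1 val) /= /val_inj.
Qed.

(** Each missing vertex below [v] lowers its position by one; the additive form avoids truncated
    subtraction. *)
Lemma position_facet (a b v : 'I_d.+3) : a != b ->
  (position (facet a b) v + (a < v) + (b < v) = v)%N.
Proof.
move=> ab; have := position_setD1 v (in_setT a).
have := @position_setD1 _ ([set: _] :\ a) b v.
rewrite !inE eq_sym ab positionT !enum_rank_ord /= /facet => /(_ isT) -> vE.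
by rewrite [RHS]vE [RHS]addnA -addnA addnC.
Qed.

(* The flow condition at the ridge missing [0], [a] and [b]. *)
Lemma flow_ridge q (g : {set 'I_d.+3} -> int) (a b : 'I_d.+3) :
    is_flow q (chain_col (simplices complete_complex d.+1) g) ->
    (0 < a < b)%N ->
  (q %| g (facet a b) - (-1) ^+ a * g (facet ord0 b)
        + (-1) ^+ b * g (facet ord0 a))%Z.
Proof.
move=> [_ flow] /andP[a0 ab].
have neq0 (c : 'I_d.+3) : (0 < c)%N -> ord0 != c by rewrite -val_eqE /= lt0n eq_sym.
have a0' := neq0 a a0; have b0' := neq0 b (ltn_trans a0 ab).
have ab' : a != b by rewrite -val_eqE /= neq_ltn ab.
(* The facets containing this ridge arise by adding back [ord0], [a] or [b], so its flow condition
   has three terms. *)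
pose t := facet a b :\ ord0.
have tE v : (v \notin t) = (v \in [set ord0; a; b]).
  by rewrite !inE; case: (v == ord0); case: (v == a); case: (v == b).
have ct : #|t| = d.
  have := cardsD1 ord0 (facet a b).
  by rewrite card_facet // !inE a0' b0' -/t add1n => -[<-].
have tC : t \in simplices complete_complex d by rewrite in_simplices_complete ?ct.
have := flow (enum_rank_in tC t).
rewrite (_ : boundary_mx _ _ = incidence_mx _ _) // incidence_mx_chain enum_rankK_in //.
rewrite sum_coincidence; last first.
  by move=> v vt; rewrite in_simplices_complete // cardsU1 vt ct.
have -> : ~: t = ord0 |: (a |: [set b]).
  by apply/setP => v; rewrite inE tE !inE orbA.
rewrite !big_setU1 ?big_set1 /=; try by rewrite !inE ?negb_or ?a0' ?b0' ?ab'.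
have -> : ord0 |: t = facet a b by rewrite setD1K // !inE a0' b0'.
have -> : a |: t = facet ord0 b.
  apply/setP => v; rewrite !inE; have [->|] /= := eqVneq v a.
    by rewrite ab' eq_sym a0'.
  by rewrite !andbT andbC.
have -> : b |: t = facet ord0 a.
  apply/setP => v; rewrite !inE; have [->|] /= := eqVneq v b.
    by rewrite eq_sym ab' eq_sym b0'.
  by rewrite !andbT andbC.
have p0 := position_facet ord0 ab'.
have pa := position_facet a b0'.
have pb := position_facet b a0'.
have -> : position (facet a b) ord0 = 0%N by move: p0 => /=; lia.
have -> : position (facet ord0 b) a = a.-1 by move: pa => /=; lia.
have -> : position (facet ord0 a) b = b.-2 by move: pb => /=; lia.
have -> : (-1) ^+ a.-1 = - (-1) ^+ a :> int by rewrite -[in RHS](prednK a0) exprS; ring.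
have -> : (-1) ^+ b.-2 = (-1) ^+ b :> int.
  have {2}-> : (b = b.-2.+2 :> nat) by lia.
  by rewrite !exprS; ring.
move/eqP; rewrite mod0z => /eqP/dvdz_mod0P.
by rewrite expr0 mul1r mulNr addrA.
Qed.

Lemma complete_complex_flow q phi :
  @nowhere_zero_flow _ complete_complex d q phi -> (d.+3 <= q)%N.
Proof.
have [g ->] := chain_colP phi => -[flow nz].
rewrite leqNgt; apply/negP => qd.
have range (a b : 'I_d.+3) : a != b -> ~~ (q %| g (facet a b))%Z.
  move=> ab; have fC : facet a b \in simplices complete_complex d.+1.
    by rewrite in_simplices_complete ?card_facet.
  case: flow => /(_ (enum_rank_in fC (facet a b))) + _.
  have := nz (enum_rank_in fC (facet a b)).
  rewrite !mxE enum_rankK_in // => g0 gq.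
  apply: contra_neqN g0 => /dvdz_mod0P E.
  by rewrite -(modz_small (d := q) gq).
(* For q = 0 the range 0 <= x < q is empty, while the complex has a facet. *)
have q_gt0 : (0 < q)%N.
  case: flow nz => + _ _.
  have fC : facet ord0 ord_max \in simplices complete_complex d.+1.
    by rewrite in_simplices_complete ?card_facet.
  move/(_ (enum_rank_in fC (facet ord0 ord_max))) => /andP[].
  by move=> /le_lt_trans /[apply].
pose y (a : 'I_d.+3) : int := if a == ord0 then 0 else (-1) ^+ a * g (facet ord0 a).
have ylt a : (`|(y a %% q)%Z| < q)%N.
  by have := ltz_pmod (y a) (d := q); rewrite ltz_nat q_gt0;
    have := modz_ge0 (y a) (d := q); lia.
(* Pigeonhole: d+3 labels take fewer than d+3 residues mod q, so two of them agree. *)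
have /injectivePn [a [b ab /(congr1 val) /= yab]] :
    ~~ injectiveb (fun a => Ordinal (ylt a)).
  by apply/negP => /injectiveP /leq_card; rewrite !card_ord leqNgt qd.
have {yab} ydvd : (q %| y a - y b)%Z.
  rewrite -eqz_mod_dvd; apply/eqP.
  have qn0 : q%:Z != 0 by lia.
  by have := modz_ge0 (y a) qn0; have := modz_ge0 (y b) qn0; move: yab; lia.
wlog lt_ab : a b ab ydvd / (a < b)%N.
  move=> W; have : (a != b :> nat) by rewrite val_eqE.
  rewrite neq_ltn => /orP[|ba]; first exact: W.
  by apply: (W b a); rewrite // 1?eq_sym // -opprB rpredN.
have sgn (n : nat) (x : int) : (q %| (-1) ^+ n * x)%Z = (q %| x)%Z.
  by rewrite -signr_odd mulr_sign; case: ifP; rewrite ?rpredN.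
have bn0 : (b == ord0) = false by rewrite -val_eqE /=; lia.
have [a0|an0] := eqVneq a ord0.
  move: ydvd; rewrite /y a0 eqxx bn0 sub0r rpredN sgn; apply/negP/range.
  by rewrite eq_sym bn0.
have ab_gt0 : (0 < a < b)%N by rewrite lt_ab lt0n andbT.
have rel := flow_ridge flow ab_gt0; apply: (negP (range a b ab)).
(* As signs square to 1, the subtracted term is exactly what the ridge relation adds to
   [g (facet a b)]. *)
suff -> : g (facet a b) = (g (facet a b) - (-1) ^+ a * g (facet ord0 b) +
    (-1) ^+ b * g (facet ord0 a)) - (-1) ^+ (a + b) * (y a - y b).
  by rewrite rpredB // sgn.
have sq (n : nat) : (-1) ^+ n * (-1) ^+ n = 1 :> int by rewrite -expr2 sqrr_sign.
rewrite /y (negbTE an0) bn0 exprD; have := sq a; have := sq b.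
move: ((-1) ^+ a) ((-1) ^+ b) => A B BB AA.
set x := g (facet ord0 a); set y0 := g (facet ord0 b).
have -> : A * B * (A * x - B * y0) = A * A * B * x - A * (B * B) * y0 by ring.
by rewrite AA BB; ring.
Qed.

End CompleteComplex.

From mathcomp Require Import classical_sets reals constructive_ereal ereal.

Theorem theorem1p3 (R : realType) (d : nat) (hd : (1 <= d)%N) :
  ((d + 2)%:R%:E < kappa R d)%E.
Proof.
(* Strictness could be lost in an infimum; it survives because flow moduli are integers, so every
   admissible bound is at least d+3. *)
apply: (@lt_le_trans _ _ (d.+3)%:R%:E); first by rewrite lte_fin ltr_nat; lia.
apply/ereal_infP => _ [k kbound <-]; rewrite lee_fin.
have [q [_ qk [phi nzphi]]] := kbound _ _ (complete_complex_simplicial d)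
  (complete_complex_dimension d) (complete_complex_bridgeless hd).
by apply: le_trans qk; rewrite ler_nat (complete_complex_flow nzphi).
Qed.
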